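(* Let $T$ be an $n$-SLTM such that $T\nsim 0_n$. Then there is a finite sequence of elementary triangular operations (ETO's) that transforms $T$ into a matrix $V$ that is in the second reduced echelon form ($2$-REF).
   Context: Let $\mathbb{F}$ be a field of characteristic different from $2$ and $\mathbb{F}^\times=\mathbb{F}\setminus\{0\}$. An $n$-SLTM is a strictly lower triangular $n\times n$ matrix with entries in $\mathbb{F}$; $0_n$ is the zero matrix. For an $n$-SLTM $T=[t_{ij}]$, $\mathcal{A}(T)$ is the commutative unital $\mathbb{F}$-algebra with generators $X_1,\dots,X_n$ and relations $X_1^2=0$ and $X_i^2=\sum_{j<i}t_{ij}X_jX_i$ for $2\le i\le n$, graded by $\deg(X_i)=2$. For two $n$-SLTM $T,S$, write $T\sim S$ if there is a degree-preserving isomorphism of $\mathbb{F}$-algebras $\mathcal{A}(T)\to\mathcal{A}(S)$; this is an equivalence relation. Intervals are intervals of integers: $[a,b]=\{m:a\le m\le b\}$, $[a,b[=\{m:a\le m<b\}$, $]a,b]=\{m:a<m\le b\}$. For an $n$-SLTM $T$, $T^{[r]}$ is its $r$-th row, and $T^{[r]}_J$ is the row of entries $t_{rj}$ with $j\in J$. For a matrix $M$, $\mu(M)$ is the number of nonzero entries of $M$. For $r\in[1,n]$ let $c_r=\max\{j:t_{rj}\ne 0\}$ if $T^{[r]}\neq 0$ and $c_r=0$ otherwise. If $c_r>0$, $t_{r,c_r}$ is the leader of the $r$-th row and $(r,c_r)$ is its leader position. For $\alpha\in\mathbb{F}$ and $1\le i<j<k\le n$ put $\Delta^{(\alpha)}_{i,j,k}(T)=\alpha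 t_{ki}+t_{kj}t_{ji}$. First reduced echelon form ($1$-REF): an $n$-SLTM $S\ne 0_n$ is in $1$-REF if (1) all zero rows of $S$ are above all nonzero rows; (2) for each leader position $(r,c)$ we have $c>1$ and there is $i_0\in[1,c[$ with $\Delta^{(2)}_{i_0,c,r}(S)\neq 0$; (3) if $(r,c_r)$ and $(r+1,c_{r+1})$ are leader positions of rows $r$ and $r+1$, then $c_r\le c_{r+1}$. The zero matrix is also in $1$-REF. Wall: for $S\neq 0_n$ in $1$-REF define recursively $r_1=\min\{r\in[1,n]:S^{[r]}\ne 0\}$ and, given $r_j$, let $A_j=\{r\in\,]r_j,n]: c_r\ge r_j\}$; if $A_j\neq\emptyset$ put $r_{j+1}=\min(A_j)$; if $A_j=\emptyset$ stop and put $\mathbb{W}(S)=(r_1,\dots,r_j)$. Also $\mathbb{W}(0_n)=(0)$. For an arbitrary $n$-SLTM $T$, $\mathbb{W}(T):=\mathbb{W}(S)$ where $S$ is any matrix in $1$-REF with $T\sim S$ (such $S$ exists and the value does not depend on the choice). When $\mathbb{W}(T)=(r_1,\dots,r_h)$ put $r_0=1$ and $r_{h+1}=n+1$. Second reduced echelon form ($2$-REF): an $n$-SLTM $T\nsim 0_n$ with $\mathbb{W}(T)=(r_1,\dots,r_h)$ is in $2$-REF if (1) $T$ has exactly $r_1-1$ zero rows and they are above the nonzero rows; (2) for each leader position $(r,c_r)$ we have $c_r>1$ and there is $i_0\in[1,c_r[$ with $\Delta^{(2)}_{i_0,c_r,r}(T)\ne 0$; moreover for each $j\in[1,h]$ and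 $r\in[r_j,r_{j+1}[$ we have $c_r\in[r_{j-1},r_j[$; (3) for each $j\in[1,h]$ and $r\in[r_j,r_{j+1}-1[$, $\mu(T^{[r]}_{[r_{j-1},r_j[})\le\mu(T^{[r+1]}_{[r_{j-1},r_j[})$. The zero matrix is also said to be in $2$-REF. Elementary triangular operations (ETO's) are the following assignments $T\mapsto S=[s_{rk}]$ on $n$-SLTM, whenever defined. $\mathcal{P}$-operation: for $1\le r_1\le n$ and $\alpha\in\mathbb{F}^\times$, $S=\mathcal{P}_{r_1}(T,\alpha)$ has $s_{rk}=\alpha^{-1}t_{rk}$ if $r=r_1$; $s_{rk}=\alpha t_{rk}$ if $k=r_1$; $s_{rk}=t_{rk}$ otherwise. $\mathcal{F}$-operation: for $1\le r_1<r_2\le n$, provided $t_{r_2j}=0$ for each $j\ge r_1$ and $t_{rr_1}=0$ for each $r_1\le r\le r_2$, $S=\mathcal{F}_{(r_1,r_2)}(T)$ has $s_{rk}=t_{r_2k}$ if $r=r_1$; $s_{rk}=t_{r_1k}$ if $r=r_2$; $s_{rk}=t_{rr_2}$ if $k=r_1$; $s_{rk}=t_{rr_1}$ if $k=r_2$; $s_{rk}=t_{rk}$ otherwise. $\mathcal{Q}$-operation: let $(r_0,k_0)$ be a position with $r_0>k_0$ and $t_{r_0,k}=0$ for all $k>k_0$, and $\beta\in\mathbb{F}^\times$. If either $k_0=1$, or $k_0>1$ and $\Delta^{(1)}_{i,k_0,r_0}(T)=\beta t_{k_0,i}$ for each $1\le i<k_0$, then $S=\mathcal{Q}_{(r_0,k_0)}(T,\beta)$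 has $s_{rk}=t_{r_0,k_0}-2\beta$ if $(r,k)=(r_0,k_0)$; $s_{rk}=t_{r,k_0}+\beta t_{r,r_0}$ if $r>r_0$ and $k=k_0$; $s_{rk}=t_{rk}$ otherwise. *)

(* Defs.v *)
From HB Require Import structures.
From Stdlib Require Import Relation_Operators.
From mathcomp Require Import all_boot all_order all_algebra.
From mathcomp Require Import ring_quotient boolp.
From mathcomp.multinomials Require Import mpoly.

Set Implicit Arguments.
Unset Strict Implicit.
Unset Printing Implicit Defensive.

Import GRing.Theory.

Local Open Scope ring_scope.
Local Open Scope quotient_scope.

(* Rows and columns are ordinals, so the row (or column) that the mathematics
   numbers r in [1, n] is the ordinal r - 1. Quantities that are row or column
   numbers in the mathematics (the c_r, the entries of walls) are kept as
   1-based natural numbers here, since 0 is one of their legal values: the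
   ordinal i has number i.+1. *)

Definition is_sltm (F : fieldType) (n : nat) (T : 'M[F]_n) : Prop :=
  forall i j : 'I_n, (i <= j)%N -> T i j = 0.

Section Algebra.
Variables (F : fieldType) (n : nat).
Implicit Type T : 'M[F]_n.

Definition relator T (i : 'I_n) : {mpoly F[n]} :=
  'X_i ^+ 2 - \sum_(j < n | (j < i)%N) T i j *: ('X_j * 'X_i).

Definition rel_ideal T (p : {mpoly F[n]}) : bool :=
  `[< exists q : 'I_n -> {mpoly F[n]}, p = \sum_(i < n) q i * relator T i >].

Lemma relator_eval0 T i : (relator T i).@[fun=> 0] = 0.
Proof.
rewrite mevalB expr2 mevalM mevalXU mul0r sub0r.
rewrite (raddf_sum (meval (fun=> 0))) big1 ?oppr0 // => j _.
apply: etrans (mevalZ _ _ _) _; by rewrite mevalM mevalXU mul0r mulr0.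
Qed.

Lemma rel_ideal_closed T : idealr_closed (rel_ideal T).
Proof.
split.
- apply/asboolP; exists (fun=> 0).
  by rewrite big1 // => i _; rewrite mul0r.
- apply/negP => /asboolP [q e].
  have := congr1 (meval (fun=> 0)) e; rewrite meval1 (raddf_sum (meval (fun=> 0))) big1.
    by move/eqP; rewrite oner_eq0.
  by move=> i _; apply: etrans (mevalM _ _ _) _; rewrite relator_eval0 mulr0.
- move=> a p q /asboolP [u ->] /asboolP [v ->]; apply/asboolP.
  exists (fun i => a * u i + v i).
  rewrite mulr_sumr -big_split; apply: eq_bigr => i _ /=.
  by rewrite mulrDl mulrA.
Qed.

Definition rel_idealr T : idealr {mpoly F[n]} :=
  HB.pack (rel_ideal T)
    (isIdealr.Build {mpoly F[n]} (rel_ideal T) (rel_ideal_closed T)).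

Definition algA T : Type := {ideal_quot (rel_idealr T)}.

HB.instance Definition _ T := GRing.ComNzRing.on (algA T).

Definition piA T (p : {mpoly F[n]}) : algA T := \pi_{ideal_quot (rel_idealr T)} p.

Lemma piAD T p q : piA T (p + q) = piA T p + piA T q.
Proof. exact: (raddfD (\pi_{ideal_quot (rel_idealr T)})). Qed.
Lemma piAM T p q : piA T (p * q) = piA T p * piA T q.
Proof. exact: (rmorphM (\pi_{ideal_quot (rel_idealr T)})). Qed.
Lemma piA1 T : piA T 1 = 1.
Proof. exact: (rmorph1 (\pi_{ideal_quot (rel_idealr T)})). Qed.

Definition scaleA T (a : F) (x : algA T) : algA T := piA T a%:MP * x.

Lemma scaleAA T a b (x : algA T) : scaleA a (scaleA b x) = scaleA (a * b) x.
Proof. by rewrite /scaleA mulrA -piAM -mpolyCM. Qed.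
Lemma scale1A T : left_id 1 (@scaleA T).
Proof. by move=> x; rewrite /scaleA mpolyC1 piA1 mul1r. Qed.
Lemma scaleADr T : right_distributive (@scaleA T) +%R.
Proof. by move=> a x y; rewrite /scaleA mulrDr. Qed.
Lemma scaleADl T (x : algA T) : {morph (@scaleA T)^~ x : a b / a + b}.
Proof. by move=> a b; rewrite /scaleA mpolyCD piAD mulrDl. Qed.

HB.instance Definition _ T := GRing.Zmodule_isLmodule.Build F (algA T)
  (@scaleAA T) (@scale1A T) (@scaleADr T) (@scaleADl T).

Lemma scaleA_mull T (a : F) (x y : algA T) : a *: (x * y) = (a *: x) * y.
Proof. exact: mulrA. Qed.

HB.instance Definition _ T :=
  GRing.Lmodule_isLalgebra.Build F (algA T) (@scaleA_mull T).
HB.instance Definition _ T := GRing.Lalgebra_isComAlgebra.Build F (algA T).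

(* Each X_i has degree 2, so a monomial m has degree 2 * mdeg m; the component
   of odd degree is {0}. *)
Definition homogA T (d : nat) (x : algA T) : Prop :=
  exists2 p : {mpoly F[n]},
    {in msupp p, forall m, (2 * mdeg m)%N = d} & piA T p = x.

Definition sim T S : Prop :=
  exists f : {lrmorphism algA T -> algA S},
    bijective f /\ forall d x, homogA d x -> homogA d (f x).

End Algebra.

Section EchelonForms.
Variables (F : fieldType) (n : nat).
Implicit Type T : 'M[F]_n.

Definition Delta (a : F) T (i j k : 'I_n) : F := a * T k i + T k j * T j i.

(* The number c_r. *)
Definition lead T (r : 'I_n) : nat := \max_(j < n | T r j != 0) j.+1.

Definition leader_pos T (r c : 'I_n) : Prop := lead T r = c.+1.

Definition zero_rows_above T : Prop :=
  forall r s : 'I_n, row r T = 0 -> row s T <> 0 -> (r < s)%N.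

Definition leaders_ok T : Prop :=
  forall r c : 'I_n, leader_pos T r c ->
    (0 < c)%N /\ exists2 i0 : 'I_n, (i0 < c)%N & Delta 2 T i0 c r <> 0.

Definition is_REF1 T : Prop :=
  is_sltm T /\
  (T = 0 \/
   [/\ T <> 0, zero_rows_above T, leaders_ok T &
       forall r s c d : 'I_n, s = r.+1 :> nat ->
         leader_pos T r c -> leader_pos T s d -> (c <= d)%N]).

Definition is_min (A : nat -> Prop) (m : nat) : Prop :=
  A m /\ forall x, A x -> (m <= x)%N.

Definition nonzero_rows T (x : nat) : Prop :=
  exists2 r : 'I_n, x = r.+1 & row r T <> 0.

Definition wall_succs T (rj : nat) (x : nat) : Prop :=
  exists r : 'I_n, [/\ x = r.+1, (rj < x)%N & (rj <= lead T r)%N].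

Inductive wall_from T : nat -> seq nat -> Prop :=
| wall_stop rj :
    (forall x, ~ wall_succs T rj x) -> wall_from T rj [:: rj]
| wall_step rj rj1 w :
    is_min (wall_succs T rj) rj1 -> wall_from T rj1 w ->
    wall_from T rj (rj :: w).

Definition wall_REF1 T (w : seq nat) : Prop :=
  (T = 0 /\ w = [:: 0%N]) \/
  (T <> 0 /\ exists2 r1, is_min (nonzero_rows T) r1 & wall_from T r1 w).

(* W(T) = w. As W(T) is computed from any matrix in 1-REF equivalent to T, it
   is introduced through its graph. *)
Definition is_wall T (w : seq nat) : Prop :=
  exists S : 'M[F]_n, [/\ is_REF1 S, sim T S & wall_REF1 S w].

(* The j-th entry r_j of the wall w = (r_1, ..., r_h), extended by r_0 = 1 and
   r_(h+1) = n + 1. *)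
Definition wall_nth (w : seq nat) (j : nat) : nat :=
  nth 0%N (1%N :: rcons w n.+1) j.

(* Number of nonzero entries of row r whose column number is in [a, b[. *)
Definition mu_row T (r : 'I_n) (a b : nat) : nat :=
  #|[set k : 'I_n | (a <= k.+1 < b)%N && (T r k != 0)]|.

Definition REF2_wrt T (w : seq nat) : Prop :=
  let r_ := wall_nth w in
  [/\ #|[set r : 'I_n | row r T == 0]| = (r_ 1%N - 1)%N /\ zero_rows_above T,
      leaders_ok T /\
      (forall (j : nat) (r : 'I_n), (1 <= j <= size w)%N ->
         (r_ j <= r.+1 < r_ j.+1)%N -> (r_ j.-1 <= lead T r < r_ j)%N) &
      forall (j : nat) (r s : 'I_n), (1 <= j <= size w)%N ->
        (r_ j <= r.+1 < r_ j.+1 - 1)%N -> s = r.+1 :> nat ->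
        (mu_row T r (r_ j.-1) (r_ j) <= mu_row T s (r_ j.-1) (r_ j))%N].

Definition is_REF2 T : Prop :=
  is_sltm T /\
  (T = 0 \/ ~ sim T 0 /\ exists2 w, is_wall T w & REF2_wrt T w).

Definition opP T (r1 : 'I_n) (a : F) : 'M[F]_n :=
  \matrix_(r, k) (if r == r1 then a^-1 * T r k
                  else if k == r1 then a * T r k
                  else T r k).

Definition opF T (r1 r2 : 'I_n) : 'M[F]_n :=
  \matrix_(r, k) (if r == r1 then T r2 k
                  else if r == r2 then T r1 k
                  else if k == r1 then T r r2
                  else if k == r2 then T r r1
                  else T r k).

Definition opQ T (r0 k0 : 'I_n) (b : F) : 'M[F]_n :=
  \matrix_(r, k) (if (r == r0) && (k == k0) then T r0 k0 - 2 * b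
                  else if (r0 < r)%N && (k == k0) then T r k0 + b * T r r0
                  else T r k).

Inductive eto T : 'M[F]_n -> Prop :=
| eto_P (r1 : 'I_n) (a : F) : a <> 0 -> eto T (opP T r1 a)
| eto_F (r1 r2 : 'I_n) :
    (r1 < r2)%N ->
    (forall j : 'I_n, (r1 <= j)%N -> T r2 j = 0) ->
    (forall r : 'I_n, (r1 <= r <= r2)%N -> T r r1 = 0) ->
    eto T (opF T r1 r2)
| eto_Q (r0 k0 : 'I_n) (b : F) :
    (k0 < r0)%N ->
    (forall k : 'I_n, (k0 < k)%N -> T r0 k = 0) ->
    b <> 0 ->
    (k0 = 0%N :> nat \/
     (0 < k0)%N /\
     forall i : 'I_n, (i < k0)%N -> Delta 1 T i k0 r0 = b * T k0 i) ->
    eto T (opQ T r0 k0 b).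

End EchelonForms.

(* Main.v *)
Require Import Defs.
From HB Require Import structures.
From Stdlib Require Import Relation_Operators.
From mathcomp Require Import all_boot all_order all_algebra.
From mathcomp Require Import boolp perm zify ring.
From mathcomp.multinomials Require Import mpoly.

(* Any violation of the first reduced echelon form can be used to decrease the
   sequence (c_1, ..., c_n) lexicographically: a leader (r, c) violating (2)
   satisfies t_ri = - t_rc t_ci / 2 for i < c, so the Q-operation with
   beta = t_rc / 2 is defined and erases the leader while otherwise touching
   only later rows; a descent c_r > c_(r+1) allows the F-operation on rows r
   and r + 1. Hence T reduces to a matrix S in 1-REF. The wall of S cuts the
   rows into blocks, each of which has its leaders in the previous block. Inside
   a block every adjacent F-operation is defined and acts as conjugation by a
   transposition, so the rows of each block can be sorted by their numbers of
   nonzero entries in the previous block. *)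

Set Implicit Arguments.
Unset Strict Implicit.
Unset Printing Implicit Defensive.

Import GRing.Theory.
Local Open Scope ring_scope.
Local Open Scope quotient_scope.

(** * Graded isomorphisms induced by linear substitutions *)

Section Substitution.
Variables (F : fieldType) (n : nat).
Implicit Types (T S V : 'M[F]_n) (a b : n.-tuple {mpoly F[n]}) (p : {mpoly F[n]}).

Lemma rel_idealD T p q :
  rel_ideal T p -> rel_ideal T q -> rel_ideal T (p + q).
Proof. exact: (@rpredD _ (rel_idealr T)). Qed.

Lemma rel_idealM T p q : rel_ideal T q -> rel_ideal T (p * q).
Proof. exact: (@idealMr _ (rel_idealr T)). Qed.

Lemma rel_ideal_sum T (I : Type) (r : seq I) (P : pred I) f :
  (forall i, P i -> rel_ideal T (f i)) -> rel_ideal T (\sum_(i <- r | P i) f i).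
Proof. by move=> h; apply: (@rpred_sum _ (rel_idealr T)). Qed.

Lemma rel_ideal_relator T i : rel_ideal T (relator T i).
Proof.
apply/asboolP; exists (fun j => (j == i)%:R).
rewrite (bigD1 i) //= eqxx mul1r big1 ?addr0 // => j /negbTE ->.
by rewrite mul0r.
Qed.

Lemma piA_eq T p q : (piA T p = piA T q) <-> rel_ideal T (p - q).
Proof.
have := @Quotient.idealrBE _ (rel_idealr T) p q.
by rewrite -[_ \in _]/(rel_ideal T (p - q)) => ->; split=> /eqP.
Qed.

Lemma piA_surj T (x : algA T) : exists p, x = piA T p.
Proof.
by exists (repr (x : {ideal_quot (rel_idealr T)})); rewrite /piA reprK.
Qed.

Lemma piAZ T c p : piA T (c *: p) = c *: piA T p.
Proof. by rewrite -mul_mpolyC piAM. Qed.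

Lemma comp_mpoly_ideal T S a :
  (forall i, rel_ideal S (relator T i \mPo a)) ->
  forall p, rel_ideal T p -> rel_ideal S (p \mPo a).
Proof.
move=> h p /asboolP [q ->]; rewrite rmorph_sum /=.
by apply: rel_ideal_sum => i _; rewrite rmorphM; apply: rel_idealM; apply: h.
Qed.

Lemma comp_mpolyK a b :
  (forall i, tnth a i \mPo b = 'X_i) -> forall p, (p \mPo a) \mPo b = p.
Proof.
move=> h p; rewrite [p \mPo a]comp_mpolyEX [RHS]mpolyE rmorph_sum.
apply: eq_bigr => m _; rewrite /= comp_mpolyZ comp_mpolyX rmorph_prod /=.
congr (_ *: _); rewrite [RHS]mpolyXE_id; apply: eq_bigr => i _.
by rewrite rmorphXn /= h.
Qed.

Lemma dhomog_comp_mpoly a d p :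
  (forall i, tnth a i \is 1.-homog) -> p \is d.-homog -> p \mPo a \is d.-homog.
Proof.
move=> ha /dhomogP hp; rewrite comp_mpolyEX big_seq.
apply: rpred_sum => m /hp /= <-; apply: rpredZ; rewrite comp_mpolyX.

rewrite mdegE; elim: (index_enum _) => [|i s IH]; first by rewrite !big_nil dhomog1.
rewrite !big_cons; apply: dhomogM => //.
by have := dhomogMn (m i) (ha i); rewrite mul1n.
Qed.

Section Induced.
Variables (T S : 'M[F]_n) (a : n.-tuple {mpoly F[n]}).
Hypothesis ha : forall i, rel_ideal S (relator T i \mPo a).

(* The unused argument makes the morphism instances below available whenever
   the substitution respects the relations. *)
Definition algA_map of (forall i, rel_ideal S (relator T i \mPo a)) :=
  fun x : algA T => piA S (repr (x : {ideal_quot (rel_idealr T)}) \mPo a).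
Local Notation f := (algA_map ha).

(** Two representatives of a class differ by an element of the ideal of [T], which the substitution
    sends into that of [S]; so the choice made by [repr] does not matter. *)
Lemma algA_map_pi p : f (piA T p) = piA S (p \mPo a).
Proof.
apply/piA_eq; rewrite -rmorphB; apply: (comp_mpoly_ideal ha).
by apply/piA_eq; rewrite /piA reprK.
Qed.

Lemma algA_map_additive : zmod_morphism f.
Proof.
move=> x y; have [[p ->] [q ->]] := (piA_surj x, piA_surj y).
have piAB U u v : piA U (u - v) = piA U u - piA U v.
  exact: (raddfB (\pi_{ideal_quot (rel_idealr U)})).
by rewrite -piAB !algA_map_pi rmorphB piAB.
Qed.

Lemma algA_map_multiplicative : monoid_morphism f.
Proof.
split=> [|x y]; first by rewrite -[1](piA1 T) algA_map_pi rmorph1 piA1.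
have [[p ->] [q ->]] := (piA_surj x, piA_surj y).
by rewrite -piAM !algA_map_pi rmorphM piAM.
Qed.

Lemma algA_map_scalable : scalable f.
Proof.
move=> c x; have [p ->] := piA_surj x.
by rewrite -piAZ !algA_map_pi linearZ piAZ.
Qed.

HB.instance Definition _ :=
  GRing.isZmodMorphism.Build (algA T) (algA S) f algA_map_additive.
HB.instance Definition _ :=
  GRing.isMonoidMorphism.Build (algA T) (algA S) f algA_map_multiplicative.
HB.instance Definition _ :=
  GRing.isScalable.Build F (algA T) (algA S) *:%R f algA_map_scalable.

End Induced.

(** The criterion applied to both kinds of operation: substitutions that are mutually inverse on the
    variables are so everywhere, and linear forms preserve degrees. *)
Lemma sim_subst T S a b :
  (forall i, rel_ideal S (relator T i \mPo a)) ->
  (forall i, rel_ideal T (relator S i \mPo b)) ->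
  (forall i, tnth a i \mPo b = 'X_i) -> (forall i, tnth b i \mPo a = 'X_i) ->
  (forall i, tnth a i \is 1.-homog) -> sim T S.
Proof.
move=> ha hb ab ba a1; exists (algA_map ha : {lrmorphism algA T -> algA S}).
split=> [|d x [p hp <-]].
  exists (algA_map hb) => x; have [p ->] := piA_surj x.
    by rewrite /= !algA_map_pi comp_mpolyK.
  by rewrite /= !algA_map_pi comp_mpolyK.
rewrite /= algA_map_pi; exists (p \mPo a) => //.
(* A zero [p] has no monomial from which to read [d]; otherwise [d] is twice the degree of any
   monomial of [p]. *)
case E: (msupp p) => [|m s].
  have -> : p = 0 by apply/eqP; rewrite -msupp_eq0 E.
  by rewrite comp_mpoly0 msupp0.
have <- : (2 * mdeg m)%N = d by apply: hp; rewrite E mem_head.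
suff /dhomogP h : p \mPo a \is (mdeg m).-homog by move=> m' /h /= ->.
apply: dhomog_comp_mpoly => //; apply/dhomogP => m' /= /hp.
have := hp m; rewrite E mem_head => /(_ isT) <-; lia.
Qed.

Lemma sim_trans T S V : sim T S -> sim S V -> sim T V.
Proof.
move=> [f [fb fh]] [g [gb gh]]; exists (g \o f : {lrmorphism _ -> _}).
by split=> [|d x /fh /gh //]; apply: bij_comp.
Qed.

Lemma sim_refl T : sim T T.
Proof. by exists idfun; split=> //; exists id. Qed.

End Substitution.

(** * Effect of permutations and Q-operations on the algebra *)

Section OperationsSim.
Variables (F : fieldType) (n : nat).
Implicit Types (T S : 'M[F]_n) (s : 'S_n) (i j r k : 'I_n).

(** For strictly lower triangular [T], the linear form L_i with X_i^2 = L_i X_i in the algebra.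
    Summing over all columns lets a permutation reindex it. *)
Definition row_form T i : {mpoly F[n]} := \sum_j T i j *: 'X_j.

Lemma relatorE T i :
  is_sltm T -> relator T i = 'X_i ^+ 2 - row_form T i * 'X_i.
Proof.
move=> hT; rewrite /relator mulr_suml; congr (_ - _).
rewrite [RHS](bigID (fun j : 'I_n => (j < i)%N)) /=.
rewrite [X in _ = _ + X]big1 ?addr0 => [|j].
  by apply: eq_bigr => j _; rewrite scalerAl.
by rewrite -leqNgt => /hT ->; rewrite scale0r mul0r.
Qed.

Lemma row_form_comp T i (a : n.-tuple {mpoly F[n]}) :
  row_form T i \mPo a = \sum_j T i j *: tnth a j.
Proof.
rewrite rmorph_sum; apply: eq_bigr => j _.
by rewrite /= comp_mpolyZ comp_mpolyXU -tnth_nth.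
Qed.

Lemma relator_comp T i (a : n.-tuple {mpoly F[n]}) : is_sltm T ->
  relator T i \mPo a = tnth a i ^+ 2 - (row_form T i \mPo a) * tnth a i.
Proof.
by move=> hT; rewrite relatorE // rmorphB rmorphXn rmorphM /= comp_mpolyXU -tnth_nth.
Qed.

Lemma sim_perm T s :
  is_sltm T -> is_sltm (mxsub s s T) -> sim T (mxsub s s T).
Proof.
pose X s := [tuple 'X_(s i) : {mpoly F[n]} | i < n].
(* Renaming variables matches the relators one by one. The matrix and permutation are arbitrary
   since the inverse substitution needs the conjugate of [T] and [s^-1]. *)
have main U s' : is_sltm U -> is_sltm (mxsub s' s' U) -> forall i,
    rel_ideal (mxsub s' s' U) (relator U i \mPo X s'^-1%g).
  move=> hU hV i; rewrite relator_comp // tnth_mktuple.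
  have -> : row_form U i \mPo X s'^-1%g = row_form (mxsub s' s' U) (s'^-1%g i).
    rewrite row_form_comp [RHS](reindex_inj (@perm_inj _ s'^-1%g)) /=.
    by apply: eq_bigr => j _; rewrite tnth_mktuple !mxE !permKV.
  by rewrite -relatorE //; apply: rel_ideal_relator.
move=> hT hS.
have TE : mxsub s^-1%g s^-1%g (mxsub s s T) = T.
  by apply/matrixP => i j; rewrite !mxE !permKV.
apply: (@sim_subst _ _ _ _ (X s^-1%g) (X s)) => i.
- exact: main.
- by have := main (mxsub s s T) s^-1%g hS; rewrite TE invgK; apply.
- by rewrite tnth_mktuple comp_mpolyXU -tnth_nth tnth_mktuple permKV.
- by rewrite tnth_mktuple comp_mpolyXU -tnth_nth tnth_mktuple permK.
- by rewrite tnth_mktuple dhomogX /= mdeg1.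
Qed.

Definition shear r k (b : F) : n.-tuple {mpoly F[n]} :=
  [tuple 'X_i + (b *+ (i == r)) *: 'X_k | i < n].

Lemma shearK r k b i : (k < r)%N -> tnth (shear r k b) i \mPo shear r k (- b) = 'X_i.
Proof.
move=> kr; rewrite tnth_mktuple rmorphD /= comp_mpolyZ !comp_mpolyXU -!tnth_nth.
rewrite !tnth_mktuple (_ : k == r = false); last by apply/eqP => e; rewrite e ltnn in kr.
by rewrite mulr0n scale0r addr0 mulNrn scaleNr subrK.
Qed.

(** Treats both cases of the Q-operation at once: if [k] is the first column, the last clause is
    vacuous. *)
Definition Q_condition T r k b :=
  [/\ (k < r)%N, forall j, (k < j)%N -> T r j = 0
    & forall i, (i < k)%N -> Delta 1 T i k r = b * T k i].

Lemma opQ_sltm T r k b : is_sltm T -> (k < r)%N -> is_sltm (opQ T r k b).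
Proof.
move=> hT kr i j ij; rewrite mxE.
case: ifP => [/andP[/eqP ei /eqP ej]|_]; first by move: ij; rewrite ei ej leqNgt kr.
case: ifP => [/andP[ri /eqP ej]|_]; last exact: hT.
by move: (ltn_trans kr ri); rewrite ltnNge -ej ij.
Qed.

Lemma opQ_row T r k b i j : is_sltm T -> i != r ->
  opQ T r k b i j = T i j + (b * T i r) *+ (j == k).
Proof.
move=> hT /negbTE ir; rewrite mxE ir /=; case: eqP => [->|_]; last first.
  by rewrite andbF addr0.
rewrite andbT; case: ltnP => // ir'.
by rewrite (hT i r) // mulr0 addr0.
Qed.

Lemma opQ_row_self T r k b j :
  opQ T r k b r j = T r j - (2 * b) *+ (j == k).
Proof. by rewrite mxE eqxx ltnn /=; case: eqP => [->|_] //; rewrite subr0. Qed.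

(** Replacing t_rk by t_rk - 2b turns the right-hand side b t_ki of the condition into -b t_ki. This
    supplies the inverse substitution in [sim_opQ]. *)
Lemma Q_condition_opp T r k b : is_sltm T -> Q_condition T r k b ->
  Q_condition (opQ T r k b) r k (- b) /\ opQ (opQ T r k b) r k (- b) = T.
Proof.
move=> hT [kr hz hD]; have hS := opQ_sltm b hT kr.
have kr' : k != r by apply/eqP => e; rewrite e ltnn in kr.
split; last first.
  apply/matrixP => i j; have [->|ir] := eqVneq i r.
    by rewrite !opQ_row_self -addrA -opprD -mulrnDl mulrN addrN mul0rn subr0.
  rewrite (opQ_row _ _ _ hS) // !opQ_row // [r == k]eq_sym (negbTE kr').
  by rewrite addr0 -addrA -mulrnDl mulNr addrN mul0rn addr0.
split=> // [j kj|i ik].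
  rewrite opQ_row_self hz // (_ : j == k = false) ?subr0 //.
  by apply/eqP => e; rewrite e ltnn in kj.
have ik' : i == k = false by apply/eqP => e; rewrite e ltnn in ik.
have := hD i ik; rewrite /Delta !opQ_row_self !opQ_row // eqxx ik' addr0 subr0.
by rewrite mulr1n mulrBl addrA => ->; ring.
Qed.

(* The relation of X_r is sent to itself plus b (b - t_rk) times the relation
   of X_k. *)
Lemma shear_relator T r k b : is_sltm T -> Q_condition T r k b ->
  forall i, rel_ideal (opQ T r k b) (relator T i \mPo shear r k b).
Proof.
move=> hT [kr hz hD] i; have hS := opQ_sltm b hT kr.
have kr' : k != r by apply/eqP => e; rewrite e ltnn in kr.
have phi j : row_form T j \mPo shear r k b = row_form T j + (b * T j r) *: 'X_k.
  rewrite row_form_comp [X in _ = _ + X](_ : _ =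
    \sum_l T j l *: ((b *+ (l == r)) *: 'X_k)).
    by rewrite -big_split; apply: eq_bigr => l _; rewrite tnth_mktuple scalerDr.
  rewrite (bigD1 r) //= big1 => [|l /negbTE ->]; last by rewrite scale0r scaler0.
  by rewrite eqxx addr0 scalerA mulrC.
have delta c : \sum_j (c *+ (j == k)) *: 'X_j = c *: 'X_k :> {mpoly F[n]}.
  rewrite (bigD1 k) //= big1 => [|l /negbTE ->]; last by rewrite scale0r.
  by rewrite eqxx addr0.
have rowS j : j != r ->
    row_form (opQ T r k b) j = row_form T j + (b * T j r) *: 'X_k.
  move=> jr; rewrite -delta -big_split; apply: eq_bigr => l _.
  by rewrite opQ_row // scalerDl.
rewrite relator_comp // phi tnth_mktuple; have [->|ir] := eqVneq i r; last first.
  by rewrite scale0r addr0 -rowS // -relatorE //; apply: rel_ideal_relator.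
have -> : ('X_r + (b *+ true) *: 'X_k) ^+ 2 - (row_form T r + (b * T r r) *: 'X_k)
    * ('X_r + (b *+ true) *: 'X_k) = relator (opQ T r k b) r
    + (b * (b - T r k))%:MP * relator (opQ T r k b) k; last first.
  by apply: rel_idealD; [|apply: rel_idealM]; apply: rel_ideal_relator.
rewrite !relatorE // (rowS k) // (hT k r) ?(ltnW kr) // (hT r r) // mulr0 scale0r !addr0.
have -> : row_form (opQ T r k b) r = row_form T r - (2 * b) *: 'X_k.
  rewrite -delta -sumrB; apply: eq_bigr => l _.
  by rewrite opQ_row_self scalerBl.
(* For j < k the Q-condition reads t_rj = (b - t_rk) t_kj; beyond column k, row r is zero. *)
have -> : row_form T r = (b - T r k) *: row_form T k + T r k *: 'X_k.
  rewrite -[T r k *: _]delta scaler_sumr -big_split; apply: eq_bigr => j _ /=.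
  rewrite scalerA -scalerDl; congr (_ *: _).
  have [jk|kj|/val_inj ->] := ltngtP j k.
  - rewrite (_ : j == k = false) ?addr0; last by apply/eqP => e; rewrite e ltnn in jk.
    by have := hD j jk; rewrite /Delta mul1r mulrBl => <-; rewrite addrK.
  - rewrite hz // (hT k) ?(ltnW kj) // mulr0.
    by rewrite (_ : j == k = false) ?addr0 //; apply/eqP => e; rewrite e ltnn in kj.
  - by rewrite (hT k k) // mulr0 eqxx add0r.
rewrite -!mul_mpolyC !(mpolyCM, mpolyCB) mpolyC_nat mulr1n; ring.
Qed.

Lemma sim_opQ T r k b :
  is_sltm T -> Q_condition T r k b -> sim T (opQ T r k b).
Proof.
move=> hT hQ; have [hQ' TE] := Q_condition_opp hT hQ; have kr : (k < r)%N by case: hQ.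
apply: (@sim_subst _ _ _ _ (shear r k b) (shear r k (- b))) => i.
- exact: shear_relator.
- by have := shear_relator (opQ_sltm b hT kr) hQ'; rewrite TE; apply.
- exact: shearK.
- by rewrite -[X in _ \mPo shear _ _ X]opprK shearK.
- rewrite tnth_mktuple; apply: dhomogD; first by rewrite dhomogX /= mdeg1.
  by apply: dhomogZ; rewrite dhomogX /= mdeg1.
Qed.

End OperationsSim.

Lemma ord_nondecreasing n (f : 'I_n -> nat) :
  (forall r s : 'I_n, s = r.+1 :> nat -> (f r <= f s)%N) ->
  forall r s : 'I_n, (r <= s)%N -> (f r <= f s)%N.
Proof.
move=> mono r s; have [k] := ubnP (s - r); elim: k r => // k IH r hk rs.
have [->//|ne] := eqVneq r s.
have rs' : (r < s)%N by rewrite ltn_neqAle rs andbT.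
have r1 : (r.+1 < n)%N by apply: leq_ltn_trans rs' _.
by apply: leq_trans (mono r (Ordinal r1) erefl) _; apply: IH => //=; lia.
Qed.

(** * Leaders of rows and a leader-free form of condition (2) *)

Section Leaders.
Variables (F : fieldType) (n : nat).
Implicit Types (T S : 'M[F]_n) (r s c j k : 'I_n).

Lemma lead_gt T r j : T r j != 0 -> (j < lead T r)%N.
Proof.
by move=> h; apply: (@leq_bigmax_cond _ [pred k | T r k != 0] (fun k => k.+1)).
Qed.

Lemma lead_leP T r m :
  reflect (forall j, T r j != 0 -> (j < m)%N) (lead T r <= m)%N.
Proof. exact: bigmax_leqP. Qed.

Lemma lead_le_row T r : is_sltm T -> (lead T r <= r)%N.
Proof.
move=> hT; apply/lead_leP => j; apply: contraNltn => rj.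
by rewrite hT.
Qed.

Lemma lead_posP T r : (0 < lead T r)%N -> exists2 c : 'I_n, lead T r = c.+1 & T r c != 0.
Proof.
have [j hj _|z] := pickP [pred j | T r j != 0]; last first.
  rewrite ltnNge => /negP []; apply/lead_leP => j hj.
  by have := z j; rewrite /= hj.
have [|c hc e] := @eq_bigmax_cond _ [pred j | T r j != 0] (fun j => j.+1).
  by apply/card_gt0P; exists j.
by exists c.
Qed.

Lemma leader_posP T r c : leader_pos T r c ->
  T r c != 0 /\ forall j, (c < j)%N -> T r j = 0.
Proof.
move=> e; have [|c' e' h] := @lead_posP T r; first by rewrite e.
have -> : c = c' by apply: val_inj; move: e; rewrite /leader_pos e' => -[].
split=> // j cj; apply/eqP; apply: contraLR cj => /lead_gt.
by rewrite e' -leqNgt.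
Qed.

Lemma row_eq0 T r : (row r T == 0) = (lead T r == 0%N).
Proof.
apply/eqP/eqP => [e|e]; last first.
  apply/rowP => j; rewrite !mxE; apply/eqP; apply/negPn/negP => /lead_gt.
  by rewrite e.
apply/eqP; rewrite -leqn0; apply/lead_leP => j.
by have := congr1 (fun u : 'rV_n => u 0 j) e; rewrite !mxE => ->; rewrite eqxx.
Qed.

Lemma row_neq0 T r j : T r j != 0 -> row r T <> 0.
Proof. by move=> /lead_gt h /eqP; rewrite row_eq0 => /eqP e; rewrite e in h. Qed.

(* The nonvanishing in [leaders_ok] automatically holds at the nonleading
   nonzero entries, with [i] the column of the leader; quantifying over all
   nonzero entries makes the condition invariant under conjugation by a
   permutation matrix. *)
Definition entries_ok T : Prop :=
  forall r c, T r c != 0 -> exists2 i, i != c & Delta 2 T i c r != 0.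

(** At a nonleading entry, the leader column c0 reduces Delta to 2 t_(r,c0), as t_(c,c0) = 0.
    Conversely, at a leader both terms of Delta vanish for i > c, so the witness lies to the left of
    c. *)
Lemma entries_okP T : 2 != 0 :> F -> is_sltm T -> leaders_ok T <-> entries_ok T.
Proof.
move=> two hT; split=> [hl r c nz|he r c /leader_posP [nz hz]].
  have [|c0 lc0 nz0] := @lead_posP T r; first exact: leq_ltn_trans (lead_gt nz).
  have [e|ne] := eqVneq c0 c.
    have [_ [i ic /eqP hi]] := hl r c0 lc0.
    by exists i; rewrite -e //; apply: contraTneq ic => ->; rewrite ltnn.
  exists c0 => //; rewrite /Delta (hT c c0) ?mulr0 ?addr0 ?mulf_neq0 //.
  by have := lead_gt nz; rewrite lc0.
have [i ne hi] := he r c nz.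
have ic : (i < c)%N.
  rewrite ltn_neqAle ne leqNgt; apply: contra hi => ci.
  by rewrite /Delta hz // (hT c i (ltnW ci)) !mulr0 addr0.
by split; [apply: leq_ltn_trans ic | exists i => //; apply/eqP].
Qed.

End Leaders.

(** * Swapping two consecutive rows and columns *)

Section AdjacentSwap.
Variables (F : fieldType) (n : nat) (T : 'M[F]_n) (a b : 'I_n).
Hypotheses (hT : is_sltm T) (ab : b = a.+1 :> nat) (Tba : T b a = 0).
Local Notation s := (tperm a b).

(** Only the entry (b, a) could cross the diagonal, and it is zero. *)
Lemma swap_sltm : is_sltm (mxsub s s T).
Proof.
have sE x : s x = if x == a :> nat then b else if x == b :> nat then a else x.
  case: tpermP => [->|->|/eqP/negbTE na /eqP/negbTE nb].
  - by rewrite eqxx.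
  - by rewrite ab eqn_leq ltnn eqxx.
  - by rewrite -!(inj_eq val_inj) /= in na nb; rewrite na nb.
move=> i j ij; rewrite mxE !sE; do 4?case: eqP => //; move=> *; apply: hT; lia.
Qed.

(** Inside rows [a] and [b], [opF] keeps the columns in place while conjugation swaps them; the
    results agree because the four entries of these rows in columns [a] and [b] vanish. *)
Lemma eto_swap : eto T (mxsub s s T).
Proof.
have <- : opF T a b = mxsub s s T.
  apply/matrixP => i j; rewrite !mxE.
  have Taa : T a a = 0 by apply: hT.
  have Tab : T a b = 0 by apply: hT; rewrite ab.
  have Tbb : T b b = 0 by apply: hT.
  have nab : b == a = false by apply/eqP => e; move: ab; rewrite e; lia.
  case: (tpermP a b i) => [->|->|/eqP/negbTE -> /eqP/negbTE ->];
  case: (tpermP a b j) => [->|->|/eqP/negbTE nja /eqP/negbTE njb];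
  by rewrite ?eqxx ?nab ?nja ?njb ?Taa ?Tab ?Tbb ?Tba.
apply: eto_F => [|j aj|r /andP[ar rb]]; first by rewrite ab.
  have [e|ne] := eqVneq a j; first by rewrite -e.
  by apply: hT; rewrite ab ltn_neqAle ne.
have [e|ne] := eqVneq a r; first by rewrite -e hT.
suff -> : r = b by [].
by apply/val_inj/eqP; rewrite /= eqn_leq rb ab ltn_neqAle ar andbT.
Qed.

Lemma sim_swap : sim T (mxsub s s T) /\ sim (mxsub s s T) T.
Proof.
split; first exact: sim_perm swap_sltm.
have e : mxsub s s (mxsub s s T) = T by apply/matrixP => i j; rewrite !mxE !tpermK.
by rewrite -[X in sim _ X]e; apply: sim_perm; rewrite ?e //; apply: swap_sltm.
Qed.

End AdjacentSwap.

(** The values of [f] are digits in base n + 1, the first being the most significant: those after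
    [r] cannot make up for the loss at [r]. *)
Lemma lex_weight_lt n (f g : 'I_n -> nat) (r : 'I_n) :
  (forall i, f i <= n)%N -> (forall i : 'I_n, (i < r)%N -> f i = g i) ->
  (f r < g r)%N ->
  (\sum_i f i * n.+1 ^ (n - i) < \sum_i g i * n.+1 ^ (n - i))%N.
Proof.
move=> fn fg fgr.
rewrite (bigID (fun i : 'I_n => (i < r)%N)).
rewrite [ltnRHS](bigID (fun i : 'I_n => (i < r)%N)) /=.
rewrite (eq_bigr (fun i => g i * n.+1 ^ (n - i))%N) => [|i /fg -> //].
rewrite ltn_add2l (bigD1 r) ?ltnn //= [ltnRHS](bigD1 r) ?ltnn //=.
apply: leq_trans (leq_addr _ _); apply: leq_trans (leq_mul fgr (leqnn _)).
rewrite mulSn addnC ltn_add2r.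
(* Geometric sum with all digits maximal; the exponents stop at 1 rather than 0, whence the extra
   [n.+1]. *)
have geom d m : (m + d = n)%N ->
    (\sum_(m <= i < n) n * n.+1 ^ (n - i) + n.+1 = n.+1 ^ d.+1)%N.
  elim: d m => [|d IH] m e; first by rewrite big_geq ?expn1 // -e addn0.
  rewrite big_ltn; last by lia.
  have -> : (n - m = d.+1)%N by lia.
  by rewrite -addnA IH; [rewrite [RHS]expnS mulSn addnC | lia].
have := geom (n - r.+1)%N r.+1; rewrite subnKC // subnSK // => /(_ erefl) <-.
apply: leq_ltn_trans (_ : _ <= \sum_(r.+1 <= i < n) n * n.+1 ^ (n - i))%N _.
  rewrite big_geq_mkord /=.
  rewrite (eq_bigl (fun i : 'I_n => r < i)%N) => [|i].
    by apply: leq_sum => i _; rewrite leq_mul2r fn orbT.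
  by rewrite -leqNgt ltn_neqAle andbC eq_sym.
by rewrite addnS ltnS leq_addr.
Qed.

(** * Reduction to 1-REF by lexicographic descent *)

Section FirstReduction.
Variables (F : fieldType) (n : nat).
Hypothesis hF : 2%N \notin [pchar F].
Implicit Types (T S : 'M[F]_n) (r s c j k : 'I_n).

Lemma two_neq0 : 2 != 0 :> F.
Proof. by move: hF; rewrite inE /=. Qed.

Definition lead_weight T := (\sum_r lead T r * n.+1 ^ (n - r))%N.

Lemma lead_weight_lt T S r : is_sltm S ->
  (forall i : 'I_n, (i < r)%N -> lead S i = lead T i) -> (lead S r < lead T r)%N ->
  (lead_weight S < lead_weight T)%N.
Proof.
move=> hS; apply: lex_weight_lt => i.
exact: leq_trans (lead_le_row i hS) (ltnW (ltn_ord i)).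
Qed.

(** A leader in the first column is covered too, the condition on Delta being then vacuous. *)
Lemma Q_step T r c : is_sltm T -> leader_pos T r c ->
  (forall i : 'I_n, (i < c)%N -> Delta 2 T i c r = 0) ->
  exists S, [/\ is_sltm S, eto T S, sim T S & (lead_weight S < lead_weight T)%N].
Proof.
move=> hT lrc hD; have [nz hz] := leader_posP lrc.
have cr : (c < r)%N.
  by rewrite ltnNge; apply: contra nz => rc; rewrite hT.
set b := T r c / 2; have b2 : 2 * b = T r c by rewrite mulrC divfK ?two_neq0.
have hQ : Q_condition T r c b.
  (* As 2b = t_rc, twice the required identity amounts to the vanishing of [Delta 2]. *)
  split=> // i ic; apply: (mulfI two_neq0); rewrite mulrA b2.
  by have := hD i ic; rewrite /Delta => e; rewrite -[RHS]addr0 -{}e; ring.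
have hS := opQ_sltm b hT cr.
exists (opQ T r c b); split=> //; last 2 first.
- exact: sim_opQ.
- apply: (@lead_weight_lt _ _ r) => // [i ir|].
    apply: eq_bigl => j; rewrite mxE (_ : i == r = false) /=; last first.
      by apply: contraTF ir => /eqP ->; rewrite ltnn.
    by rewrite [(r < i)%N]ltnNge (ltnW ir).
  rewrite lrc ltnS; apply/lead_leP => j; rewrite opQ_row_self => nzj.
  rewrite ltn_neqAle; apply/andP; split.
    apply: contra nzj => /eqP/val_inj ->.
    by rewrite eqxx mulr1n b2 subrr.
  rewrite leqNgt; apply: contra nzj => cj; rewrite hz //.
  by rewrite (_ : j == c = false) ?subr0 //; apply: contraTF cj => /eqP ->; rewrite ltnn.
apply: eto_Q => //.
  by move=> b0; move: nz; rewrite -b2 b0 mulr0 eqxx.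
have [c0|c0] := posnP c; first by left.
by right; split=> // i ic; case: hQ => _ _; apply.
Qed.

(** Row [s] vanishes in columns [r] and [s] because its leader lies before that of row [r]. So the
    swap puts the old row [s] in place of row [r] and leaves the rows above untouched. *)
Lemma F_step T r s : is_sltm T -> s = r.+1 :> nat -> (lead T s < lead T r)%N ->
  exists S, [/\ is_sltm S, eto T S, sim T S & (lead_weight S < lead_weight T)%N].
Proof.
move=> hT rs lsr; have lr := lead_le_row r hT.
have Tsr : T s r = 0.
  by apply/eqP/negPn/negP => /lead_gt; lia.
have hS := swap_sltm hT rs Tsr.
exists (mxsub (tperm r s) (tperm r s) T); split=> //.
- exact: eto_swap.
- by have [] := sim_swap hT rs Tsr.
apply: (@lead_weight_lt _ _ r) => // [i ir|].
  apply: eq_bigl => j; rewrite mxE tpermD; last 2 first.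
  - by apply: contraTneq ir => ->; rewrite ltnn.
  - by apply: contraTneq ir => <-; rewrite rs; lia.
  by case: tpermP => // ->; rewrite !hT //; lia.
apply: leq_ltn_trans (lsr); apply/lead_leP => j; rewrite mxE tpermL => /lead_gt.
by case: tpermP => [->|->|//]; lia.
Qed.

Lemma reduce_REF1 T : is_sltm T ->
  exists S, [/\ clos_refl_trans _ (@eto F n) T S, sim T S & is_REF1 S].
Proof.
have [m] := ubnP (lead_weight T); elim: m T => // m IH T /ltnSE wT hT.
have step : (exists S,
      [/\ is_sltm S, eto T S, sim T S & (lead_weight S < lead_weight T)%N]) ->
    exists S, [/\ clos_refl_trans _ (@eto F n) T S, sim T S & is_REF1 S].
  move=> [S [hS TS simS wS]].
  have [V [SV simV hV]] := IH S (leq_trans wS wT) hS.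
  exists V; split=> //; last exact: sim_trans simV.
  by apply: rt_trans SV; apply: rt_step.
case: (boolP [exists r, exists c : 'I_n, (lead T r == c.+1) &&
         [forall i : 'I_n, (i < c)%N ==> (Delta 2 T i c r == 0)]]) => [|hQ].
  move=> /existsP [r /existsP [c /andP [/eqP lrc /forallP hD]]].
  by apply/step/(Q_step hT lrc) => i ic; apply/eqP/(implyP (hD i)).
case: (boolP [exists r : 'I_n, exists s : 'I_n,
         (s == r.+1 :> nat) && (lead T s < lead T r)%N]).
  by move=> /existsP [r /existsP [s /andP [/eqP rs lsr]]]; apply/step/(F_step hT rs).
move=> hP; exists T; split; [exact: rt_refl | exact: sim_refl | split=> //].
have [->|/eqP nz] := eqVneq T 0; [by left | right].
(* Without descents the c_r are nondecreasing, which gives both conditions (1) and (3). *)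
have mono r s : s = r.+1 :> nat -> (lead T r <= lead T s)%N.
  move=> rs; rewrite leqNgt; apply: contra hP => lsr.
  by apply/existsP; exists r; apply/existsP; exists s; rewrite rs eqxx.
split=> // [r s /eqP|r c lrc|r s c d rs lrc lsd].
- rewrite row_eq0 => /eqP lr0 /eqP; rewrite row_eq0 => ls0.
  rewrite ltnNge; apply: contra ls0 => sr; rewrite -leqn0 -lr0.
  exact: ord_nondecreasing mono _ _ sr.
- have : ~~ [forall i : 'I_n, (i < c)%N ==> (Delta 2 T i c r == 0)].
    apply: contra hQ => h; apply/existsP; exists r; apply/existsP; exists c.
    by rewrite lrc eqxx.
  rewrite negb_forall => /existsP [i]; rewrite negb_imply => /andP [ic hi].
  by split; [apply: leq_ltn_trans ic | exists i => //; apply/eqP].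
- by have := mono r s rs; rewrite lrc lsd ltnS.
Qed.

End FirstReduction.

(** * Walls and the blocks they cut out *)

Section Walls.
Variables (F : fieldType) (n : nat).
Implicit Types (T S V : 'M[F]_n) (w : seq nat) (r s c j k : 'I_n) (x p : nat).

Lemma ex_is_min (A : nat -> Prop) : (exists x, A x) -> exists m, is_min A m.
Proof.
move=> [x Ax]; have exA : exists x, `[< A x >] by exists x; apply/asboolP.
exists (ex_minn exA); case: ex_minnP => m /asboolP Am hm.
by split=> // y Ay; apply/hm/asboolP.
Qed.

Lemma ex_wall_from T x : exists w, wall_from T x w.
Proof.
have [m] := ubnP (n - x); elim: m x => // m IH x hm.
have [[y hy]|no] := pselect (exists y, wall_succs T x y); last first.
  by exists [:: x]; apply: wall_stop => y hy; apply: no; exists y.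
have [z hz] := ex_is_min (ex_intro _ y hy).
have [w hw] : exists w, wall_from T z w.
  by apply: IH; case: hz => -[r [-> xr _]] _; have := ltn_ord r; lia.
by exists (x :: w); apply: wall_step hz hw.
Qed.

Lemma wall_from_path T x w : (x <= n)%N -> wall_from T x w ->
  exists2 w', w = x :: w' & path ltn x (rcons w' n.+1).
Proof.
move=> xn h; elim: h xn => {x w} [x _ xn|x y w [[r [e xy _]] _] _ IH xn].
  by exists [::] => //=; rewrite ltnS xn.
have [|w' -> hw'] := IH; first by rewrite e ltn_ord.
by exists (y :: w') => //=; rewrite xy.
Qed.

(** Here [p] stands for the entry before [x], so that the induction runs over tails of the wall. A
    row of the block of [x] is either row [x] itself or not a successor of [x], by minimality of the
    next entry; either way its leader is before [x]. *)
Lemma wall_from_lead T p x w : is_sltm T ->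
  (forall r s, (r <= s)%N -> (lead T r <= lead T s)%N) ->
  wall_from T x w -> (forall r, (x <= r.+1)%N -> (p <= lead T r)%N) ->
  forall i r, (1 <= i <= size w)%N ->
  let u := nth 0%N (p :: rcons w n.+1) in
  (u i <= r.+1 < u i.+1)%N -> (u i.-1 <= lead T r < u i)%N.
Proof.
move=> hT mono h.
elim: h p => {x w} [x hx|x y w [[q [ey xy ly]] hy] hw IH] p hp [|i] r //=.
  case: i => [|i] //= _ /andP [xr _]; rewrite hp //= ltnNge.
  have [xr'|rx] := ltnP x r.+1.
    by apply/negP => xl; apply: (hx r.+1); exists r.
  by rewrite -ltnNge (leq_trans _ rx) // ltnS lead_le_row.
case: i => [|i] /= hi.
  have -> : nth 0%N (rcons w n.+1) 0 = y by case: hw.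
  move=> /andP [xr ry]; rewrite hp //= ltnNge.
  have [xr'|rx] := ltnP x r.+1.
    apply/negP => xl; have : (y <= r.+1)%N by apply: hy; exists r.
    by rewrite leqNgt ry.
  by rewrite -ltnNge (leq_trans _ rx) // ltnS lead_le_row.
move=> hr; apply: (IH x _ i.+1) => // s ys; apply: leq_trans ly _.
by apply: mono; rewrite -ltnS -ey.
Qed.

(** For increasing [w], the index j of the block [r_j, r_(j+1)[ holding row or column [x], and 0
    before r_1. *)
Definition wall_block w x := count (fun t => t <= x.+1)%N w.

Lemma wall_block_mono w x y : (x <= y)%N -> (wall_block w x <= wall_block w y)%N.
Proof. by move=> xy; apply: sub_count => t /= tx; apply: leq_trans tx _. Qed.

Lemma nth_leq_count w i x : sorted ltn w -> (i < size w)%N ->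
  (nth 0%N w i <= x)%N = (i < count (fun t => t <= x)%N w)%N.
Proof.
elim: w i => // a w IH i hs; have sw := path_sorted hs.
have [ax|xa] := leqP a x.
  case: i => [|i] hi /=; rewrite ax //.
  by rewrite add1n ltnS; apply: IH.
have z : count (fun t => t <= x)%N w = 0%N.
  apply/eqP; rewrite -leqn0 leqNgt -has_count; apply/hasPn => t tw.
  have /allP /(_ t tw) /= := order_path_min ltn_trans hs.
  by rewrite -ltnNge; apply: ltn_trans.
case: i => [|i] hi /=; rewrite [(a <= x)%N]leqNgt xa z //.
by rewrite add0n ltn0; have := IH i sw hi; rewrite z.
Qed.

(** Excludes the wall (0) of the zero matrix. *)
Definition wall_shaped w := (0 < size w)%N && path ltn 0 (rcons w n.+1).

Lemma wall_shaped_sorted w : wall_shaped w -> sorted ltn w.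
Proof. by case/andP => _; rewrite rcons_path => /andP [/path_sorted]. Qed.

Lemma wall_block_geq w i r : wall_shaped w -> (i <= size w)%N ->
  (wall_nth n w i <= r.+1)%N = (i <= wall_block w r)%N.
Proof.
move=> hw; case: i => // i iw.
by rewrite /wall_nth /= nth_rcons iw nth_leq_count ?wall_shaped_sorted.
Qed.

Lemma wall_block_ltn w i r : wall_shaped w -> (i <= size w)%N ->
  (r.+1 < wall_nth n w i.+1)%N = (wall_block w r <= i)%N.
Proof.
move=> hw; rewrite leq_eqVlt => /orP [/eqP ->|iw].
  by rewrite /wall_nth /= nth_rcons ltnn eqxx ltnS ltn_ord count_size.
by rewrite ltnNge wall_block_geq // -ltnNge ltnS.
Qed.

(** The conventions r_0 = 1 and r_(h+1) = n + 1 make this uniform from the rows above r_1 to the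
    last block. *)
Lemma wall_blockE w i r : wall_shaped w -> (i <= size w)%N ->
  (wall_nth n w i <= r.+1 < wall_nth n w i.+1)%N = (wall_block w r == i).
Proof.
by move=> hw iw; rewrite wall_block_geq // wall_block_ltn // -eqn_leq eq_sym.
Qed.

(* The conditions (1) and (2) of the second reduced echelon form, stated in
   terms of blocks so as to be visibly invariant under simultaneous
   permutations of rows and columns inside the blocks. *)
Record block_echelon w T : Prop := BlockEchelon {
  be_sltm : is_sltm T;
  be_lower : forall r c, T r c != 0 -> (wall_block w c < wall_block w r)%N;
  be_prev : forall r, (0 < wall_block w r)%N ->
    exists2 c, T r c != 0 & (wall_block w c).+1 = wall_block w r;
  be_entries : entries_ok T }.

Lemma REF1_block_echelon S : 2 != 0 :> F -> is_REF1 S -> S <> 0 ->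
  exists w, [/\ wall_REF1 S w, wall_shaped w & block_echelon w S].
Proof.
move=> two [hS [//|[_ hz hl hm]]] nz.
(* Condition (3) compares only nonzero rows; condition (1) forbids a zero row after a nonzero
   one. *)
have mono r s : (r <= s)%N -> (lead S r <= lead S s)%N.
  apply: (ord_nondecreasing (f := lead S)) => {}r {}s rs.
  rewrite leqNgt; apply/negP => lsr.
  have [|c lc _] := @lead_posP _ _ S r; first exact: leq_ltn_trans lsr.
  have [ls0|/lead_posP [d ld _]] := posnP (lead S s).
    have rowr : row r S <> 0 by move=> /eqP; rewrite row_eq0 lc.
    have rows : row s S = 0 by apply/eqP; rewrite row_eq0 ls0.
    by have := hz s r rows rowr; rewrite rs ltnNge leqnSn.
  by have := hm r s c d rs lc ld; move: lsr; rewrite lc ld ltnS ltnNge => /negP.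
have [x0 hx0] : exists x, nonzero_rows S x.
  apply: contrapT => no; apply: nz; apply/row_matrixP => r; rewrite row0.
  by apply: contrapT => nr; apply: no; exists r.+1, r.
have [x [hx xmin]] := ex_is_min (ex_intro _ x0 hx0).
have [w hw] := ex_wall_from S x.
have [q ex nq] := hx.
have xn : (x <= n)%N by rewrite ex ltn_ord.
have [w' ew pw] := wall_from_path xn hw.
have shw : wall_shaped w by rewrite /wall_shaped ew /= pw ex.
have lpos r : (x <= r.+1)%N -> (1 <= lead S r)%N.
  rewrite ex ltnS => /mono; apply: leq_trans; rewrite lt0n -row_eq0.
  exact/eqP.
have blk r : (0 < wall_block w r)%N ->
    (wall_nth n w (wall_block w r).-1 <= lead S r < wall_nth n w (wall_block w r))%N.
  move=> r0; apply: (wall_from_lead hS mono hw lpos); first by rewrite r0 count_size.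
  by rewrite -[X in (X <= _ < _)%N]/(wall_nth n w _) wall_blockE ?count_size.
exists w; split=> //; first by right; split=> //; exists x.
split=> // [r c nzr|r r0|]; last by apply/entries_okP.
  have r0 : (0 < wall_block w r)%N.
    rewrite -(@wall_block_geq w 1 r) //; last by case/andP: shw.
    by rewrite /wall_nth ew /=; apply: xmin; exists r => //; apply: row_neq0 nzr.
  have /andP [_ hlt] := blk r r0.
  have := leq_ltn_trans (lead_gt nzr) hlt.
  rewrite -{1}(prednK r0) wall_block_ltn ?(leq_trans (leq_pred _)) ?count_size //.
  by rewrite -ltnS prednK.
have /andP [hle hlt] := blk r r0.
have [|c lc nzc] := @lead_posP _ _ S r.
  by apply: lpos; have := @wall_block_geq w 1 r shw; rewrite r0 /wall_nth ew /= => ->.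
exists c => //; rewrite -(prednK r0); congr _.+1; apply/eqP.
by rewrite -wall_blockE ?(leq_trans (leq_pred _)) ?count_size // (prednK r0) -lc hle hlt.
Qed.

(** * Sorting the rows inside the blocks *)

Definition block_mu w T r :=
  #|[set k : 'I_n | ((wall_block w k).+1 == wall_block w r) && (T r k != 0)]|.

(** Nonzero entries sit in columns of strictly earlier blocks, so t_sr = 0; and the transposition
    preserves block indices. *)
Lemma swap_block_echelon w T r s : block_echelon w T -> s = r.+1 :> nat ->
  wall_block w r = wall_block w s ->
  [/\ T s r = 0, block_echelon w (mxsub (tperm r s) (tperm r s) T)
    & forall i, block_mu w (mxsub (tperm r s) (tperm r s) T) i =
                block_mu w T (tperm r s i)].
Proof.
move=> [hT hl hp he] rs brs.
have Tsr : T s r = 0 by apply/eqP/negPn/negP => /hl; rewrite brs ltnn.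
have bE i : wall_block w (tperm r s i) = wall_block w i by case: tpermP => // ->.
split=> // [|i].
  split; first exact: swap_sltm.
  - by move=> i j; rewrite mxE => /hl; rewrite !bE.
  - move=> i i0; have [|c nz bc] := hp (tperm r s i); first by rewrite bE.
    by exists (tperm r s c); rewrite ?mxE ?tpermK // bE bc bE.
  - move=> i j; rewrite mxE => /he [k kj hk]; exists (tperm r s k).
      by rewrite -(inj_eq (@perm_inj _ (tperm r s))) tpermK.
    by rewrite /Delta !mxE !tpermK.
rewrite /block_mu -(card_imset _ (@perm_inj _ (tperm r s))).
apply: eq_card => k; rewrite !inE; apply/imsetP/idP => [[l]|h].
  by rewrite !inE !mxE => h ->; rewrite !bE.
by exists (tperm r s k); rewrite ?tpermK // !inE mxE !bE tpermK -[wall_block w i]bE.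
Qed.

(** The weights of rows [r] and [s] differ by one, so the sum drops by exactly f r - f s. *)
Lemma swap_weight_lt (f : 'I_n -> nat) r s : s = r.+1 :> nat -> (f s < f r)%N ->
  (\sum_(i < n) (n - i) * f (tperm r s i) < \sum_(i < n) (n - i) * f i)%N.
Proof.
move=> rs fsr; have sr : s != r by apply/eqP => e; move: rs; rewrite e; lia.
rewrite (bigD1 r) // [ltnRHS](bigD1 r) //= (bigD1 s) // [in ltnRHS](bigD1 s) //=.
rewrite tpermL tpermR !addnA (eq_bigr (fun i : 'I_n => (n - i) * f i)%N) => [|i].
  rewrite ltn_add2r rs; have := ltn_ord s; rewrite rs => rn.
  rewrite (_ : n - r = (n - r.+1).+1)%N; [rewrite !mulSn; lia | lia].
by case/andP => ir is_; rewrite tpermD // eq_sym.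
Qed.

(** A bubble sort. Both directions of [sim] are kept: one shows that the result is not equivalent to
    0, the other carries the wall over to it. *)
Lemma sort_blocks w T : block_echelon w T ->
  exists V, [/\ clos_refl_trans _ (@eto F n) T V, sim T V, sim V T,
    block_echelon w V &
    forall r s, s = r.+1 :> nat -> wall_block w r = wall_block w s ->
      (block_mu w V r <= block_mu w V s)%N].
Proof.
have [m] := ubnP (\sum_(i < n) (n - i) * block_mu w T i)%N.
elim: m T => // m IH T /ltnSE hm hT.
case: (boolP [exists r : 'I_n, exists s : 'I_n, [&& s == r.+1 :> nat,
   wall_block w r == wall_block w s & (block_mu w T s < block_mu w T r)%N]]); last first.
  move=> no; exists T; split=> //; [exact: rt_refl | exact: sim_refl | exact: sim_refl |].
  move=> r s rs brs; rewrite leqNgt; apply: contra no => h.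
  by apply/existsP; exists r; apply/existsP; exists s; rewrite brs rs !eqxx.
move=> /existsP [r /existsP [s /and3P [/eqP rs /eqP brs lt]]].
have [Tsr hS muE] := swap_block_echelon hT rs brs.
have [TS ST] := sim_swap (be_sltm hT) rs Tsr.
have [|//|V [SV simSV simVS hV hmu]] := IH (mxsub (tperm r s) (tperm r s) T).
  apply: leq_trans hm; under eq_bigr do rewrite muE.
  exact: swap_weight_lt.
exists V; split=> //; try exact: sim_trans simSV; try exact: sim_trans ST.
by apply: rt_trans SV; apply/rt_step/eto_swap => //; apply: be_sltm hT.
Qed.

Lemma card_ord_ltn x : (x <= n)%N -> #|[set r : 'I_n | (r < x)%N]| = x.
Proof.
move=> xn; rewrite -sum1_card; under eq_bigl do rewrite inE.
by rewrite (big_ord_narrow xn) sum1_card card_ord.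
Qed.

Lemma block_echelon_REF2 w V : 2 != 0 :> F -> wall_shaped w -> block_echelon w V ->
  (forall r s, s = r.+1 :> nat -> wall_block w r = wall_block w s ->
    (block_mu w V r <= block_mu w V s)%N) ->
  REF2_wrt V w.
Proof.
move=> two hw [hV hl hp he] hmu; have w0 : (0 < size w)%N by case/andP: hw.
(* No block precedes block 0, so its rows are zero; [be_prev] makes all other rows nonzero. *)
have row0E r : (row r V == 0) = (wall_block w r == 0%N).
  have [b0|/hp [c nz _]] := posnP (wall_block w r).
    apply/eqP/rowP => c; rewrite !mxE; apply/eqP/negPn/negP => /hl.
    by rewrite b0.
  by apply/negbTE/eqP; apply: row_neq0 nz.
split; [split|split|].
- rewrite -[RHS]card_ord_ltn.
    apply: eq_card => r; rewrite !inE row0E -leqn0 -wall_block_ltn //.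
    by rewrite ltn_subRL add1n.
  rewrite leq_subLR add1n; case/andP: hw; rewrite /wall_nth.
  case: (w) => //= a w' _ /andP [_ /(order_path_min ltn_trans) /allP h].
  by apply/ltnW/h; rewrite mem_rcons mem_head.
- move=> r s /eqP; rewrite row0E => /eqP br /eqP; rewrite row0E -lt0n => bs.
  rewrite ltnNge; apply: contraL bs => sr; rewrite -leqNgt -br.
  exact: wall_block_mono.
- exact/entries_okP.
- move=> i r /andP [i0 iw]; rewrite wall_blockE // => /eqP bi.
  have [|c nzc bc] := hp r; first by rewrite bi.
  have [|d ld nzd] := @lead_posP _ _ V r; first exact: leq_ltn_trans (lead_gt nzc).
  (* The leader column [d] is not left of [c], which is in the previous block, and by [be_lower] it
     lies before the block of [r]; so it is in the previous block. *)
  have cd : (c <= d)%N by have := lead_gt nzc; rewrite ld ltnS.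
  rewrite ld -[X in (_ < wall_nth n w X)%N](prednK i0).
  rewrite wall_blockE ?(leq_trans (leq_pred _)) // eqn_leq -ltnS prednK // -bi hl //=.
  by rewrite -bc /=; apply: wall_block_mono.
- move=> i r s hi /andP [ir ri] rs.
  have muE k : wall_block w k = i ->
      mu_row V k (wall_nth n w i.-1) (wall_nth n w i) = block_mu w V k.
    move=> bk; case/andP: hi => i0 iw; apply: eq_card => l; rewrite !inE.
    rewrite -{2}(prednK i0) wall_blockE ?(leq_trans (leq_pred _)) //.
    by rewrite bk -[in RHS](prednK i0) eqSS.
  have iw : (i <= size w)%N by case/andP: hi.
  have br : wall_block w r = i.
    by apply/eqP; rewrite -wall_blockE // ir /=; lia.
  (* The bound r_(i+1) - 1 on row [r] keeps the next row in the same block. *)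
  have bs : wall_block w s = i.
    by apply/eqP; rewrite -wall_blockE // rs; apply/andP; split; lia.
  by rewrite !muE //; apply: hmu; rewrite ?br.
Qed.

End Walls.

Theorem proposition3p30 (F : fieldType) (hF : 2%N \notin [pchar F])
    (n : nat) (T : 'M[F]_n) (hT : is_sltm T) (hT0 : ~ sim T 0) :
  exists V : 'M[F]_n, clos_refl_trans _ (@eto F n) T V /\ is_REF2 V.
Proof.
have two := two_neq0 hF.
have [S [TS simTS hS]] := reduce_REF1 hF hT.
have nzS : S <> 0 by move=> e; apply: hT0; rewrite -e.
have [w [wS shw beS]] := REF1_block_echelon two hS nzS.
have [V [SV simSV simVS beV muV]] := sort_blocks beS.
exists V; split; first exact: rt_trans SV.
split; first exact: be_sltm beV.
right; split; first by move=> h; apply/hT0/(sim_trans simTS)/(sim_trans simSV).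
(* The wall of [V] is read off [S], which is in 1-REF and equivalent to [V]. *)
exists w; last exact: block_echelon_REF2.
by exists S.
Qed.
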